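(* Let $\mathbb{K}$ be a field of characteristic zero and let $\mathcal{W}(2)$ be the conservative algebra of $2$-dimensional algebras over $\mathbb{K}$. Every local $\frac12$-derivation of $\mathcal{W}(2)$ is a $\frac12$-derivation of $\mathcal{W}(2)$.
   Context: Algebras are vector spaces over $\mathbb{K}$ with a bilinear multiplication; they need not be associative, commutative or unital. The algebra $\mathcal{W}(2)$ (Kantor's algebra of all bilinear multiplications on a $2$-dimensional space) is the $8$-dimensional algebra over $\mathbb{K}$ with basis $e_1,\dots,e_8$ and the following multiplication (left factor first; all products of basis elements not listed are $0$): $e_1e_1=-e_1$, $e_1e_4=e_4$, $e_1e_5=-2e_5$, $e_1e_6=-e_6$, $e_1e_7=-e_7$; $e_2e_1=-e_2-e_3$, $e_2e_2=-e_4$, $e_2e_3=-e_4$, $e_2e_5=e_1-e_6-e_7$, $e_2e_6=e_2-e_8$, $e_2e_7=e_3-e_8$, $e_2e_8=e_4$; $e_5e_1=e_5$, $e_5e_2=-e_1+e_6$, $e_5e_3=-e_1+e_7$, $e_5e_4=-e_2-e_3+e_8$, $e_5e_6=-e_5$, $e_5e_7=-e_5$, $e_5e_8=-e_6-e_7$; $e_6e_2=-e_2$, $e_6e_3=-e_3$, $e_6e_4=-2e_4$, $e_6e_5=e_5$, $e_6e_8=-e_8$. A linear map $d:\mathcal{A}\to\mathcal{A}$ on an algebra $\mathcal{A}$ is a $\frac12$-derivation if $d(xy)=\frac12\big(d(x)y+x\,d(y)\big)$ for all $x,y\in\mathcal{A}$. A linear map $D:\mathcal{A}\to\mathcal{A}$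 is a local $\frac12$-derivation if for every $x\in\mathcal{A}$ there exists a $\frac12$-derivation $d_x$ of $\mathcal{A}$ such that $D(x)=d_x(x)$. *)

(* Defs.v *)
From mathcomp Require Import all_boot all_algebra.

Set Implicit Arguments.
Unset Strict Implicit.
Unset Printing Implicit Defensive.

Import GRing.Theory.
Local Open Scope ring_scope.

(* Only the underlying multiplication of an algebra matters below, so it is
   passed as a binary operation on a K-module. *)
Section HalfDerivations.
Variables (K : fieldType) (A : lmodType K) (mul : A -> A -> A).

Definition half_derivation (d : {linear A -> A}) : Prop :=
  forall x y : A, d (mul x y) = 2%:R^-1 *: (mul (d x) y + mul x (d y)).

Definition local_half_derivation (D : {linear A -> A}) : Prop :=
  forall x : A, exists d : {linear A -> A}, half_derivation d /\ D x = d x.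

End HalfDerivations.

Section W2.
Variable K : fieldType.

(* W2_e k is e_k for 1 <= k <= 8 (the coordinates themselves are numbered from
   0), and 0 for other k. *)
Definition W2_e (k : nat) : 'rV[K]_8 := \row_(j < 8) (j.+1 == k)%:R.

Local Notation e := W2_e.

Definition W2_table (i j : nat) : 'rV[K]_8 :=
  match i, j with
  | 1, 1 => - e 1
  | 1, 4 => e 4
  | 1, 5 => - (2%:R *: e 5)
  | 1, 6 => - e 6
  | 1, 7 => - e 7
  | 2, 1 => - e 2 - e 3
  | 2, 2 => - e 4
  | 2, 3 => - e 4
  | 2, 5 => e 1 - e 6 - e 7
  | 2, 6 => e 2 - e 8
  | 2, 7 => e 3 - e 8
  | 2, 8 => e 4
  | 5, 1 => e 5
  | 5, 2 => - e 1 + e 6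
  | 5, 3 => - e 1 + e 7
  | 5, 4 => - e 2 - e 3 + e 8
  | 5, 6 => - e 5
  | 5, 7 => - e 5
  | 5, 8 => - e 6 - e 7
  | 6, 2 => - e 2
  | 6, 3 => - e 3
  | 6, 4 => - (2%:R *: e 4)
  | 6, 5 => e 5
  | 6, 8 => - e 8
  | _, _ => 0
  end.

Definition W2_mul (x y : 'rV[K]_8) : 'rV[K]_8 :=
  \sum_(i < 8) \sum_(j < 8) (x 0 i * y 0 j) *: W2_table i.+1 j.+1.

Lemma W2_mul_e (i j : 'I_8) : W2_mul (W2_e i.+1) (W2_e j.+1) = W2_table i.+1 j.+1.
Proof.
rewrite /W2_mul (bigD1 i) //= [X in _ + X]big1 => [|k /negPf nki]; last first.
  by apply: big1 => l _; rewrite mxE eqSS val_eqE nki mul0r scale0r.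
rewrite addr0 (bigD1 j) //= [X in _ + X]big1 => [|k /negPf nkj]; last first.
  by rewrite !mxE !eqSS !val_eqE nkj mulr0 scale0r.
by rewrite !mxE !eqxx mulr1 scale1r addr0.
Qed.

End W2.

(* Main.v *)
Require Import Defs.
From mathcomp Require Import all_boot all_algebra.
From mathcomp Require Import ring.
Local Open Scope ring_scope.

Set Implicit Arguments.
Unset Strict Implicit.
Unset Printing Implicit Defensive.
Import GRing.Theory.

(** Every half-derivation of W(2) is a multiple of the identity, so a local
half-derivation is a linear map for which every vector is an eigenvector. Such
a map is itself a multiple of the identity ([all_eigenvectors_scalar]), hence a
half-derivation.

To see that a half-derivation d is scalar, start from e_1.  Comparing
coordinates in d(e_1 e_1) = (d(e_1) e_1 + e_1 d(e_1)) / 2, where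
e_1 e_1 = - e_1, shows that d(e_1) = c e_1 ([W2_half_derivation_e1]). Since
half-derivations form a vector space containing the identity, d - c id is again
one, and it kills e_1; it remains to show that a half-derivation d killing e_1
is zero ([W2_killing_e1_eq0]).

The basis vectors are eigenvectors of the left multiplication L by e_1, with
weights 1 (e_4), 0 (e_2, e_3, e_8), -1 (e_1, e_6, e_7) and -2 (e_5). From
d(e_1) = 0 one gets L d = 2 d L, so d doubles weights
([W2_killing_e1_weight]). As 2 and -4 are not weights, d kills e_4 and e_5.
It sends e_6 and e_7 to multiples of e_5, and these vanish because
e_6 e_1 = e_7 e_1 = 0 while e_5 e_1 = e_5. Finally d maps the span of e_2,
e_3, e_8 to itself; the left multiplication by e_5 sends this span
injectively into the span of e_1, e_6, e_7, which d kills, and d(e_5) = 0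
makes it commute with d up to a factor 2; so d is zero there too. *)

(** * Integers in a field of characteristic zero *)

Lemma pchar0_natr_neq0 (K : fieldType) (char0 : [pchar K] =i pred0) (n : nat) :
  (n.+1%:R : K) != 0.
Proof. by rewrite (iffLR (pcharf0P K) char0). Qed.

Lemma pchar0_intr_inj (K : fieldType) (char0 : [pchar K] =i pred0) (m n : int) :
  m%:~R = n%:~R :> K -> m = n.
Proof.
move=> /eqP; rewrite -subr_eq0 -rmorphB /= => mn0; apply/eqP.
rewrite -subr_eq0; case: (m - n) mn0 => [k | k].
  by rewrite -pmulrn (iffLR (pcharf0P K) char0).
by rewrite NegzE rmorphN /= oppr_eq0 -pmulrn (negPf (pchar0_natr_neq0 char0 k)).
Qed.

(** * Half-derivations of a bilinear multiplication *)

Section HalfDerivations.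
Variables (K : fieldType) (A : lmodType K) (mul : A -> A -> A).
Hypothesis mul_linearl : forall y, linear (mul^~ y).
Hypothesis mul_linearr : forall x, linear (mul x).
Hypothesis two_neq0 : 2%:R != 0 :> K.

Let scale2 (x : A) : 2%:R *: (2%:R^-1 *: x) = x.
Proof. by rewrite scalerA mulfV // scale1r. Qed.

Lemma half_derivationE (d : {linear A -> A}) x y : half_derivation mul d ->
  2%:R *: d (mul x y) = mul (d x) y + mul x (d y).
Proof. by move=> ->; rewrite scale2. Qed.

Let mulZl a x y : mul (a *: x) y = a *: mul x y.
Proof.
have mul0l : mul 0 y = 0.
  by have := mul_linearl y (-1) 0 0; rewrite scaler0 addr0 scaleN1r addNr.
by have := mul_linearl y a x 0; rewrite addr0 mul0l addr0.
Qed.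

Let mulZr a x y : mul x (a *: y) = a *: mul x y.
Proof.
have mul0r : mul x 0 = 0.
  by have := mul_linearr x (-1) 0 0; rewrite scaler0 addr0 scaleN1r addNr.
by have := mul_linearr x a y 0; rewrite addr0 mul0r addr0.
Qed.

Lemma half_derivation_scalar (d : {linear A -> A}) (c : K) :
  (forall x, d x = c *: x) -> half_derivation mul d.
Proof.
move=> dE x y; rewrite !dE mulZl mulZr -mulr2n -scaler_nat.
by rewrite [RHS]scalerA mulVf // scale1r.
Qed.

(** Allows one to normalize a half-derivation with d(x) = c x on a chosen
vector x so that it kills x. *)
Lemma half_derivation_sub_scalar (d : {linear A -> A}) (c : K) :
  half_derivation mul d -> half_derivation mul (d \- c \*: idfun).
Proof.
move=> dP x y /=.
have mulBl u v w : mul (u - v) w = mul u w - mul v w.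
  by rewrite addrC -scaleN1r mul_linearl scaleN1r addrC.
have mulBr u v w : mul u (v - w) = mul u v - mul u w.
  by rewrite addrC -scaleN1r mul_linearr scaleN1r addrC.
rewrite dP mulBl mulBr mulZl mulZr addrACA -opprD [in RHS]scalerBr.
congr (_ - _); rewrite -mulr2n -scaler_nat.
by rewrite [RHS]scalerA mulVf // scale1r.
Qed.

(** If d kills x then d commutes, up to the factor 2, with the left
multiplication by x, so it sends its eigenvectors for a to eigenvectors for 2a
(or to 0). *)
Lemma half_derivation_mul_killedl (d : {linear A -> A}) x y :
  half_derivation mul d -> d x = 0 -> mul x (d y) = 2%:R *: d (mul x y).
Proof.
by move=> dP dx0; rewrite half_derivationE // dx0 -(scale0r 0) mulZl scale0r add0r.
Qed.

Lemma half_derivation_mul_killedr (d : {linear A -> A}) x y :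
  half_derivation mul d -> d y = 0 -> mul (d x) y = 2%:R *: d (mul x y).
Proof.
by move=> dP dy0; rewrite half_derivationE // dy0 -(scale0r 0) mulZr scale0r addr0.
Qed.

End HalfDerivations.

(** * Linear maps with only eigenvectors *)

(** The eigenvalues at the basis vectors all agree with the eigenvalue at
their sum, the all-ones vector: each of them is a coordinate of the image of
that vector. *)
Lemma all_eigenvectors_scalar (K : fieldType) (n : nat)
    (D : {linear 'rV[K]_n -> 'rV[K]_n}) :
  (forall x, exists c : K, D x = c *: x) ->
  exists c : K, forall x, D x = c *: x.
Proof.
move=> eigD; pose b i := D (delta_mx 0 i) 0 i.
have Db i : D (delta_mx 0 i) = b i *: delta_mx 0 i.
  by rewrite /b; have [c ->] := eigD (delta_mx 0 i); rewrite !mxE !eqxx mulr1.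
have [c Dc] := eigD (const_mx 1); exists c => x.
have bE i : b i = c.
  have := congr1 (fun v : 'rV_n => v 0 i) Dc.
  rewrite [X in D X]row_sum_delta linear_sum summxE (bigD1 i) //=.
  rewrite big1 => [|j ji]; last first.
    by rewrite mxE scale1r Db !mxE eq_sym (negPf ji) andbF mulr0.
  by rewrite addr0 !mxE scale1r Db !mxE !eqxx !mulr1.
rewrite {1}[x]row_sum_delta linear_sum [in RHS](row_sum_delta x) scaler_sumr.
by apply: eq_bigr => i _; rewrite linearZ /= Db bE !scalerA mulrC.
Qed.

(** * Coordinates and products in W(2) *)

Section W2.
Variable K : fieldType.
Implicit Types (x y : 'rV[K]_8) (i j k : nat).
Local Notation e := (@W2_e K).
Local Notation "x *w y" := (@W2_mul K x y) (at level 40).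

Lemma W2_mul_linearl y : linear ((@W2_mul K)^~ y).
Proof.
move=> a u v; rewrite /W2_mul scaler_sumr -big_split /=; apply: eq_bigr => i _.
rewrite scaler_sumr -big_split /=; apply: eq_bigr => j _.
by rewrite !mxE mulrDl scalerDl scalerA mulrA.
Qed.

Lemma W2_mul_linearr x : linear (@W2_mul K x).
Proof.
move=> a u v; rewrite /W2_mul scaler_sumr -big_split /=; apply: eq_bigr => i _.
rewrite scaler_sumr -big_split /=; apply: eq_bigr => j _.
by rewrite !mxE mulrDr scalerDl scalerA mulrCA.
Qed.

(** Coordinates numbered from 1, like the basis vectors and the rows of the
multiplication table. *)
Definition W2_coord y k : K := y 0 (inord k.-1).
Local Notation "y `[ k ]" := (W2_coord y k) (at level 2, format "y `[ k ]").

Lemma W2_sum_coord (V : zmodType) (F : K -> nat -> V) y :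
  \sum_(i < 8) F (y 0 i) i.+1 = \sum_(1 <= i < 9) F y`[i] i.
Proof.
by rewrite big_add1 big_mkord; apply: eq_bigr => i _; rewrite /W2_coord inord_val.
Qed.

Lemma W2_expand y : y = \sum_(1 <= j < 9) y`[j] *: e j.
Proof.
rewrite [LHS]row_sum_delta -(W2_sum_coord (fun a j => a *: e j)).
apply: eq_bigr => j _; congr (_ *: _).
by apply/rowP=> k; rewrite !mxE eqxx eqSS.
Qed.

Lemma W2_coord_inj x y : (forall k, (0 < k < 9)%N -> x`[k] = y`[k]) -> x = y.
Proof.
move=> xy; rewrite (W2_expand x) (W2_expand y).
by apply: eq_big_nat => k /xy ->.
Qed.

Lemma W2_coord_e j k : (0 < k < 9)%N -> (e j)`[k] = (k == j)%:R.
Proof. by case/andP=> k0 k9; rewrite /W2_coord mxE inordK prednK. Qed.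

Lemma W2_coordZ a y k : (a *: y)`[k] = a * y`[k].
Proof. by rewrite /W2_coord mxE. Qed.

Lemma W2_coordD x y k : (x + y)`[k] = x`[k] + y`[k].
Proof. by rewrite /W2_coord mxE. Qed.

Lemma W2_coordN y k : (- y)`[k] = - y`[k].
Proof. by rewrite /W2_coord mxE. Qed.

Lemma W2_coord0 k : (0 : 'rV[K]_8)`[k] = 0.
Proof. by rewrite /W2_coord mxE. Qed.

Definition W2_coordE := (W2_coordD, W2_coordN, W2_coordZ, W2_coord0).

Lemma W2_mulE x y :
  x *w y = \sum_(1 <= i < 9) \sum_(1 <= j < 9) (x`[i] * y`[j]) *: W2_table K i j.
Proof.
rewrite -(W2_sum_coord (fun a i =>
  \sum_(1 <= j < 9) (a * y`[j]) *: W2_table K i j)).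
apply: eq_bigr => i _.
by rewrite -(W2_sum_coord (fun b j => (x 0 i * b) *: W2_table K i.+1 j)).
Qed.

Lemma W2_mul_el i y : (0 < i < 9)%N ->
  e i *w y = \sum_(1 <= j < 9) y`[j] *: W2_table K i j.
Proof.
move=> i_lt9; rewrite W2_mulE (bigD1_seq i) ?mem_index_iota ?iota_uniq //=.
rewrite [X in _ + X]big_nat_cond [X in _ + X]big1 => [|k /andP[k_lt9 ki]]; last first.
  by apply: big1 => j _; rewrite W2_coord_e // (negPf ki) mul0r scale0r.
by rewrite addr0; apply: eq_bigr => j _; rewrite W2_coord_e // eqxx mul1r.
Qed.

Lemma W2_mul_er x j : (0 < j < 9)%N ->
  x *w e j = \sum_(1 <= i < 9) x`[i] *: W2_table K i j.
Proof.
move=> j_lt9; rewrite W2_mulE; apply: eq_bigr => i _.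
rewrite (bigD1_seq j) ?mem_index_iota ?iota_uniq //=.
rewrite [X in _ + X]big_nat_cond [X in _ + X]big1 => [|k /andP[k_lt9 kj]]; last first.
  by rewrite W2_coord_e // (negPf kj) mulr0 scale0r.
by rewrite addr0 W2_coord_e // eqxx mulr1.
Qed.

(** Eigenvalues of the left multiplication by e_1, as integers so that they
can be compared by computation. *)
Definition W2_weight (k : nat) : int :=
  match k with
  | 1 | 6 | 7 => -1
  | 4 => 1
  | 5 => - 2%:Z
  | _ => 0
  end.

Lemma W2_coord_mul_e1l y k : (0 < k < 9)%N ->
  (e 1 *w y)`[k] = (W2_weight k)%:~R * y`[k].
Proof.
move=> k_lt9; rewrite W2_mul_el // unlock /= !W2_coordE !W2_coord_e //.
by case: k k_lt9 => [|[|[|[|[|[|[|[|[|k]]]]]]]]] //= _; ring.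
Qed.

Lemma W2_mul_e1r x : x *w e 1 = - x`[1] *: e 1 - x`[2] *: (e 2 + e 3) + x`[5] *: e 5.
Proof.
apply: W2_coord_inj => k k_lt9.
by rewrite W2_mul_er // unlock /= !W2_coordE !W2_coord_e //; ring.
Qed.

Lemma W2_mul_e5l y :
  e 5 *w y = - (y`[2] + y`[3]) *: e 1 + (y`[2] - y`[8]) *: e 6
    + (y`[3] - y`[8]) *: e 7 + (y`[1] - y`[6] - y`[7]) *: e 5
    - y`[4] *: (e 2 + e 3 - e 8).
Proof.
apply: W2_coord_inj => k k_lt9.
by rewrite W2_mul_el // unlock /= !W2_coordE !W2_coord_e //; ring.
Qed.

Lemma W2_mul_e1_eigen j : (0 < j < 9)%N -> e 1 *w e j = (W2_weight j)%:~R *: e j.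
Proof.
move=> j_lt9; apply: W2_coord_inj => k k_lt9.
rewrite W2_coord_mul_e1l // W2_coordZ !W2_coord_e //.
by case: eqP => [->|_] //; rewrite !mulr0.
Qed.

(** * Half-derivations of W(2) are scalar *)

Section HalfDerivation.
Hypothesis char0 : [pchar K] =i pred0.

Let two_neq0 : 2%:R != 0 :> K := pchar0_natr_neq0 char0 1.
Let killedl := half_derivation_mul_killedl W2_mul_linearl two_neq0.
Let killedr := half_derivation_mul_killedr W2_mul_linearr two_neq0.

(** With a = d(e_1), the identity at e_1 e_1 = - e_1 reads
a e_1 + e_1 a + 2 a = 0. The left multiplication by e_1 is diagonal and the
right one is nearly so; only in the first coordinate do the coefficients of a
cancel. *)
Lemma W2_half_derivation_e1 (d : {linear 'rV[K]_8 -> 'rV[K]_8}) :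
  half_derivation (@W2_mul K) d -> d (e 1) = (d (e 1))`[1] *: e 1.
Proof.
move=> dP; set a := d (e 1).
have aE k : (0 < k < 9)%N -> (a *w e 1)`[k] + (2%:Z + W2_weight k)%:~R * a`[k] = 0.
  move=> k_lt9; have := half_derivationE two_neq0 (e 1) (e 1) dP.
  move/(congr1 (W2_coord^~ k)).
  rewrite /= (W2_mul_e _ ord0 ord0) /= linearN W2_coordZ W2_coordN W2_coordD.
  rewrite W2_coord_mul_e1l // -/a => ak.
  have -> : (2%:Z + W2_weight k)%:~R * a`[k]
     = (W2_weight k)%:~R * a`[k] - 2 * - a`[k] by ring.
  by rewrite ak; ring.
have natr_mul_eq0 n (z : K) : n.+1%:R * z = 0 -> z = 0.
  by move/eqP; rewrite mulf_eq0 (negPf (pchar0_natr_neq0 char0 n)) => /eqP.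
(* a`[2] and a`[5] come first: they are the only coordinates of a, besides
   a`[1], that occur in a e_1. *)
have a2 : a`[2] = 0.
  have := aE 2 isT; rewrite W2_mul_e1r !W2_coordE !W2_coord_e //= => a2.
  by rewrite -a2; ring.
have a5 : a`[5] = 0.
  have := aE 5 isT; rewrite W2_mul_e1r !W2_coordE !W2_coord_e //= => a5.
  by rewrite -a5; ring.
apply: W2_coord_inj => k k_lt9; rewrite W2_coordZ W2_coord_e //.
have := aE k k_lt9; rewrite W2_mul_e1r a2 a5 !W2_coordE !W2_coord_e //.
case: k k_lt9 => [|[|[|[|[|[|[|[|[|k]]]]]]]]] //= _ ak.
all: rewrite ?mulr1 ?mulr0 //.
(* Coordinates 3, 4, 6, 7, 8 remain; the multiple of a`[k] that vanishes is
   the weight of e_k plus 2, that is 2, 3, 1, 1, 2. *)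
- by apply: (natr_mul_eq0 1); rewrite -ak; ring.
- by apply: (natr_mul_eq0 2); rewrite -ak; ring.
- by apply: (natr_mul_eq0 0); rewrite -ak; ring.
- by apply: (natr_mul_eq0 0); rewrite -ak; ring.
- by apply: (natr_mul_eq0 1); rewrite -ak; ring.
Qed.

Section KillingE1.
Variable d : {linear 'rV[K]_8 -> 'rV[K]_8}.
Hypothesis dP : half_derivation (@W2_mul K) d.
Hypothesis de1 : d (e 1) = 0.

(** The relation L d = 2 d L for the left multiplication L by e_1: images have
twice the weight. Characteristic zero keeps distinct integer weights distinct
in K. *)
Lemma W2_killing_e1_weight j k : (0 < j < 9)%N -> (0 < k < 9)%N ->
  W2_weight k != 2 * W2_weight j -> (d (e j))`[k] = 0.
Proof.
move=> j_lt9 k_lt9 nkj; apply/eqP; have := killedl (e j) dP de1.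
rewrite W2_mul_e1_eigen // linearZ => /(congr1 (W2_coord^~ k)) /eqP.
rewrite /= W2_coord_mul_e1l // !W2_coordZ -subr_eq0 mulrA -mulrBl mulf_eq0.
case/orP=> // /eqP kj; case/eqP: nkj; apply: (pchar0_intr_inj char0).
by apply/eqP; rewrite rmorphM /= -subr_eq0 kj.
Qed.

(** Neither 2 nor -4 is a weight. *)
Lemma W2_killing_e1_e45 j : (j == 4) || (j == 5) -> d (e j) = 0.
Proof.
move=> j45; apply: W2_coord_inj => k k_lt9; rewrite W2_coord0.
apply: W2_killing_e1_weight => //; first by case/orP: j45 => /eqP->.
case/orP: j45 => /eqP->;
  by case: k k_lt9 => [|[|[|[|[|[|[|[|[|k]]]]]]]]].
Qed.

(** Only e_5 has weight -2, so the images are multiples of e_5; the right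
multiplication by e_1 fixes e_5 but annihilates e_6 and e_7. *)
Lemma W2_killing_e1_e67 j : (j == 6) || (j == 7) -> d (e j) = 0.
Proof.
move=> j67; have j_lt9 : (0 < j < 9)%N by case/orP: j67 => /eqP->.
have ej_e1 : e j *w e 1 = 0.
  by rewrite W2_mul_e1r; case/orP: j67 => /eqP->;
    rewrite !W2_coord_e //= oppr0 !scale0r subr0 addr0.
have dj5 : (d (e j))`[5] = 0.
  have := killedr (e j) dP de1; rewrite ej_e1 linear0 scaler0.
  move/(congr1 (W2_coord^~ 5)).
  by rewrite /= W2_mul_e1r !W2_coordE !W2_coord_e //= => dj5; rewrite -dj5; ring.
apply: W2_coord_inj => k k_lt9; rewrite W2_coord0.
have [-> // | nk5] := eqVneq k 5.
apply: W2_killing_e1_weight => //; case/orP: j67 => /eqP->;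
  by case: k nk5 k_lt9 => [|[|[|[|[|[|[|[|[|k]]]]]]]]].
Qed.

(** The image z of e_j stays in the span of e_2, e_3, e_8. Since d kills e_5
and also e_5 e_j, which lies in the span of e_1, e_6, e_7, one has e_5 z = 0,
and the left multiplication by e_5 is injective on the span of e_2, e_3,
e_8. *)
Lemma W2_killing_e1_e238 j : [|| j == 2, j == 3 | j == 8] -> d (e j) = 0.
Proof.
move=> j238; have j_lt9 : (0 < j < 9)%N by case/or3P: j238 => /eqP->.
set z := d (e j).
have e5z k : (0 < k < 9)%N -> (e 5 *w z)`[k] = 0.
  move=> k_lt9; rewrite (killedl (e j) dP (@W2_killing_e1_e45 5 isT)) W2_mul_e5l.
  rewrite !W2_coord_e // !(linearD, linearB, linearN, linearZ) /= de1.
  rewrite (@W2_killing_e1_e45 5) // !(@W2_killing_e1_e67 6, @W2_killing_e1_e67 7) //.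
  by case/or3P: j238 => /eqP-> /=; rewrite !(scaler0, oppr0, scale0r, addr0, W2_coord0).
have := e5z 1 isT; have := e5z 6 isT; have := e5z 7 isT.
rewrite W2_mul_e5l !W2_coordE !W2_coord_e //= => e5z7 e5z6 e5z1.
(* The three equations are z2 + z3 = 0, z2 = z8 and z3 = z8;
   together they give 2 z8 = 0. *)
have z8 : z`[8] = 0.
  apply: (mulfI two_neq0); rewrite mulr0 -[RHS]oppr0 -[in RHS]e5z1.
  by rewrite -[LHS]addr0 -[in LHS]e5z6 -[LHS]addr0 -[in LHS]e5z7; ring.
have z2 : z`[2] = 0 by rewrite z8 in e5z6; rewrite -e5z6; ring.
have z3 : z`[3] = 0 by rewrite z8 in e5z7; rewrite -e5z7; ring.
apply: W2_coord_inj => k k_lt9; rewrite W2_coord0.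
have [/or3P[] /eqP-> // | nk] := boolP [|| k == 2, k == 3 | k == 8].
apply: W2_killing_e1_weight => //; case/or3P: j238 => /eqP->;
  by case: k nk k_lt9 => [|[|[|[|[|[|[|[|[|k]]]]]]]]].
Qed.

Lemma W2_killing_e1_eq0 x : d x = 0.
Proof.
rewrite (W2_expand x) linear_sum big_nat big1 // => k k_lt9; rewrite linearZ /=.
suff -> : d (e k) = 0 by rewrite scaler0.
case: k k_lt9 => [|[|[|[|[|[|[|[|[|k]]]]]]]]] // _;
  first [exact: de1 | exact: W2_killing_e1_e45
     | exact: W2_killing_e1_e67 | exact: W2_killing_e1_e238].
Qed.

End KillingE1.
End HalfDerivation.
End W2.

Theorem theorem1p2 (K : fieldType) (char0 : [pchar K] =i pred0)
    (D : {linear 'rV[K]_8 -> 'rV[K]_8}) :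
  local_half_derivation (@W2_mul K) D -> half_derivation (@W2_mul K) D.
Proof.
move=> Dloc; have two_neq0 : 2%:R != 0 :> K := pchar0_natr_neq0 char0 1.
have [x | c Dc] := all_eigenvectors_scalar (D := D).
  have [d [dP ->]] := Dloc x; pose c := W2_coord (d (W2_e K 1)) 1; exists c.
  have d'P := half_derivation_sub_scalar
    (@W2_mul_linearl K) (@W2_mul_linearr K) two_neq0 c dP.
  apply/eqP; rewrite -subr_eq0; apply/eqP.
  apply: (W2_killing_e1_eq0 char0 d'P) => /=.
  by rewrite {1}(W2_half_derivation_e1 char0 dP) subrr.
exact: half_derivation_scalar (@W2_mul_linearl K) (@W2_mul_linearr K) two_neq0 _ _ Dc.
Qed.
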